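(* For integers $r\geq 2$ and $N\in\mathbf{N}$, let $G_{N,r}$ be a random variable with probability generating function $\operatorname{E}[q^{G_{N,r}}] = r^{-N}\cdot G_N^{(r)}(q)$, where $G_N^{(r)}(q)$ is the generalized Galois number. Then $$\operatorname{E}[G_{N,r}] = \frac{r-1}{4r}N(N-1),\qquad \operatorname{Var}(G_{N,r}) = \frac{(r-1)(r+1)}{72r^2}N(N-1)(2N+5).$$ For fixed $r$ and $N\to\infty$, the distribution of the random variable $$\frac{G_{N,r}-\operatorname{E}[G_{N,r}]}{\operatorname{Var}(G_{N,r})^{1/2}}$$ converges weakly to the standard normal distribution.
   Context: $\mathbf{N}=\{0,1,2,\dots\}$. For a variable $q$, $[k]_q! = \prod_{i=1}^k \frac{1-q^i}{1-q}$. For $N\in\mathbf{N}$ and $\mathbf{k}=(k_1,\dots,k_r)\in\mathbf{N}^r$ the $q$-multinomial coefficient is $\left[{N \atop \mathbf{k}}\right]_q = \frac{[N]_q!}{[k_1]_q!\cdots[k_r]_q!}$ if $k_1+\cdots+k_r=N$, and $0$ otherwise; it is a polynomial in $q$. The generalized Galois number is the polynomial $G_N^{(r)}(q)=\sum_{\mathbf{k}\in\mathbf{N}^r}\left[{N\atop\mathbf{k}}\right]_q$. It has nonnegative integer coefficients and satisfies $G_N^{(r)}(1)=r^N$; for $q$ a prime power it equals the number of flags $0=V_0\subseteq\cdots\subseteq V_r=\mathbf{F}_q^N$ of length $r$, repetitions allowed. *)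

(* Defs.v *)
From HB Require Import structures.
From mathcomp Require Import all_boot all_order all_algebra.
From mathcomp Require Import all_classical all_reals all_analysis.
From mathcomp Require Import measurable_realfun.

Set Implicit Arguments.
Unset Strict Implicit.
Unset Printing Implicit Defensive.

Import Order.TTheory GRing.Theory Num.Theory.
Import numFieldNormedType.Exports.

Local Open Scope classical_set_scope.
Local Open Scope ring_scope.

Section galois_number.
Variable F : fieldType.

Definition qnat (i : nat) : {poly F} := (1 - 'X^i) %/ (1 - 'X).

Definition qfact (k : nat) : {poly F} := \prod_(1 <= i < k.+1) qnat i.

(* The Euclidean quotient is exact, by [qfact_prod_dvdp] below. *)
Definition qmultinomial (N r : nat) (k : 'I_r -> nat) : {poly F} :=
  if (\sum_j k j)%N == N then qfact N %/ \prod_j qfact (k j) else 0.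

(* Every index vector with an entry exceeding N contributes 0, so the sum over
   all vectors of natural numbers reduces to the vectors with entries <= N. *)
Definition galois_number (r N : nat) : {poly F} :=
  \sum_(k : {ffun 'I_r -> 'I_N.+1}) qmultinomial N (fun j => k j : nat).

Let X1_neq0 : 1 - 'X != 0 :> {poly F}.
Proof. by rewrite -oppr_eq0 opprB polyXsubC_eq0. Qed.

Lemma qnatE i : qnat i = \sum_(j < i) 'X^j.
Proof.
rewrite /qnat; have -> : 1 - 'X^i = (\sum_(j < i) 'X^j) * (1 - 'X) :> {poly F}.
  by rewrite -[LHS]opprB subrX1 -mulNr opprB mulrC.
by rewrite mulpK.
Qed.

Lemma qnatD m n : qnat (m + n) = qnat m + 'X^m * qnat n.
Proof.
rewrite !qnatE big_split_ord /=; congr (_ + _).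
by rewrite mulr_sumr; apply: eq_bigr => j _; rewrite exprD.
Qed.

Lemma qfactS k : qfact k.+1 = qfact k * qnat k.+1.
Proof. by rewrite /qfact big_nat_recr. Qed.

Lemma qfact_mul_dvdp m n : qfact m * qfact n %| qfact (m + n).
Proof.
have [s] := ubnP (m + n); elim: s m n => // s IH [|m] [|n] lt_s.
- by rewrite {1}/qfact big_nil mul1r.
- by rewrite {1}/qfact big_nil mul1r.
- by rewrite {2}/qfact big_nil mulr1 addn0.
rewrite addSn [qfact (m + n.+1).+1]qfactS -addSn qnatD mulrDr dvdp_add //.
- rewrite qfactS mulrAC dvdp_mul //.
  by rewrite IH //; move: lt_s; rewrite addSn.
- rewrite [qfact n.+1]qfactS mulrA [X in _ %| X]mulrCA dvdp_mull // dvdp_mul //.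
  by rewrite addnS -addSn IH //; move: lt_s; rewrite addnS.
Qed.

Lemma qfact_prod_dvdp (r : nat) (k : 'I_r -> nat) :
  \prod_j qfact (k j) %| qfact (\sum_j k j)%N.
Proof.
elim/big_rec2: _ => [|j n p _ IH]; first exact: dvd1p.
by apply: dvdp_trans (qfact_mul_dvdp _ _); rewrite dvdp_mul.
Qed.

End galois_number.

Definition natrfun (R : realType) : nat -> R := fun n => n%:R.

Lemma measurable_natrfun (R : realType) : measurable_fun setT (natrfun R).
Proof. by []. Qed.

HB.instance Definition _ (R : realType) :=
  isMeasurableFun.Build _ _ _ _ (natrfun R) (@measurable_natrfun R).

Section random_variables.
Context d (T : measurableType d) (R : realType) (P : probability T R).
Variable X : {RV P >-> nat}.

Definition real_rv : {RV P >-> R} := natrfun R \o X.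

Definition pgf (q : R) : \bar R := 'E_P[(fun w => q ^+ X w)].

(* |q| <= 1 is the range on which every generating function of a variable with
   values in the natural numbers converges. *)
Definition has_pgf (g : R -> R) : Prop :=
  forall q : R, `|q| <= 1 -> pgf q = (g q)%:E.

(* Division by zero gives 0, which only matters for a degenerate [X]. *)
Definition standardized : T -> R := fun w =>
  (real_rv w - fine 'E_P[real_rv]) / Num.sqrt (fine 'V_P[real_rv]).

Lemma measurable_standardized : measurable_fun setT standardized.
Proof.
apply: measurable_funM; last exact: measurable_cst.
by apply: measurable_funB; [exact: measurable_funPT|exact: measurable_cst].
Qed.

HB.instance Definition _ :=
  isMeasurableFun.Build _ _ _ _ standardized measurable_standardized.

End random_variables.

(* [R] and [measurableTypeR R] carry the same Borel sigma-algebra under two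
   displays: laws of real random variables live on the former, the library's
   normal distribution on the latter. *)
Definition weakly_cvg (R : realType) (mu : nat -> probability R R)
    (nu : probability (measurableTypeR R) R) : Prop :=
  forall f : R -> R, continuous f -> bounded_fun f ->
    (\int[mu n]_x (f x)%:E)%E @[n --> \oo] --> (\int[nu]_x (f x)%:E)%E.

(* Main.v *)
Require Import Defs.
From mathcomp Require Import all_boot all_order all_algebra.
From mathcomp Require Import all_classical all_reals all_analysis.
From mathcomp Require Import measurable_realfun ring lra zify.

(** The generalized Galois number is the generating function of the number of
    inversions over the words of length [N] on [r] letters: the words in which the
    letter [j] occurs [k j] times contribute the q-multinomial coefficient of [k]
    (MacMahon, [qmultinomial_words]).  A variable with values in the natural numbers
    is determined by its generating function on [(0, 1]], so that every expectation
    under [G] is an average over uniformly random words ([law_inversions]).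

    Let [U] be the centred letter divided by [r].  For two letters [x] and [y],
    the indicator of [y < x] minus its mean equals [U x - U y + U (y - x)], where the
    last difference is taken modulo [r] ([descent_decomposition]).  Summation over the
    pairs of positions writes the number of inversions as its mean, plus a weighted
    sum [L] of independent centred letters, plus the sum [D] of the terms
    [U (w j - w i)] for [i < j].  As [w j - w i] is uniform modulo [r] even when one of
    the two letters is fixed, all the terms of [L] and [D] are pairwise uncorrelated.
    The variance follows exactly ([avg_inversions_sqr]), and [D] carries only the share
    [3 / (2 * N + 5)] of it, so that the limit law is that of [L].

    The normal limit of [L] is obtained by Stein's method ([stein_weighted_sum]).
    Given [f] bounded and continuous, the product of [f - a] with a cutoff at distance
    [K] has compact support and, for the right constant [a], normal mean zero; the
    Stein equation [g' x - x * g x = (f x - a) * cutoff K x] then has a compactly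
    supported solution.  The functions [g'] and [g' x - x * g x] are hence uniformly
    continuous, in the form [`|u (x + h) - u x| <= e + C * h ^+ 2], while the cutoff
    costs at most [e * (1 + x ^+ 2)] ([stein_test_function]).  All the errors are thus
    second moments, which are known exactly. *)

Import Order.TTheory GRing.Theory Num.Theory.
Import numFieldNormedType.Exports.

Set Implicit Arguments.
Unset Strict Implicit.
Unset Printing Implicit Defensive.

Local Open Scope classical_set_scope.
Local Open Scope ring_scope.

(** * Words and inversions *)

Local Notation word N r := {ffun 'I_N -> 'I_r}.

Definition inversions N r (w : word N r) : nat :=
  \sum_(i < N) \sum_(j < N) ((i < j) && (w j < w i))%N.

Definition word_cons N r (x : 'I_r) (w : word N r) : word N.+1 r :=
  [ffun i => oapp w x (unlift ord0 i)].

Lemma word_cons0 N r (x : 'I_r) (w : word N r) : word_cons x w ord0 = x.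
Proof. by rewrite ffunE unlift_none. Qed.

Lemma word_consS N r (x : 'I_r) (w : word N r) i :
  word_cons x w (lift ord0 i) = w i.
Proof. by rewrite ffunE liftK. Qed.

(** Words are split at their first letter, which makes inductions on the
    length possible. *)
Lemma sum_word_cons (V : nmodType) N r (P : pred (word N.+1 r))
    (F : word N.+1 r -> V) :
  \sum_(w | P w) F w =
  \sum_x \sum_(w : word N r | P (word_cons x w)) F (word_cons x w).
Proof.
rewrite pair_big_dep /=.
rewrite (reindex (fun p : 'I_r * word N r => word_cons p.1 p.2)) //=.
exists (fun w : word N.+1 r => (w ord0, [ffun i => w (lift ord0 i)])).
  move=> [x w] _ /=; congr pair; first by rewrite word_cons0.
  by apply/ffunP => i; rewrite ffunE word_consS.
move=> w _ /=; apply/ffunP => i; rewrite ffunE.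
by case: unliftP => [j ->|->] //=; rewrite ffunE.
Qed.

Lemma inversions_cons N r (x : 'I_r) (w : word N r) :
  inversions (word_cons x w) = (\sum_(i < N) (w i < x) + inversions w)%N.
Proof.
rewrite /inversions big_ord_recl /=; congr addn.
  rewrite big_ord_recl /= add0n; apply: eq_bigr => i _.
  by rewrite word_consS word_cons0.
apply: eq_bigr => i _; rewrite big_ord_recl /= add0n.
by apply: eq_bigr => j _; rewrite !word_consS.
Qed.

(** * Averages over uniformly random words *)

(** The expectation under the uniform distribution on words. *)
Definition avg (R : numFieldType) N r (F : word N r -> R) : R :=
  r%:R ^- N * \sum_w F w.

Definition update N r (w : word N r) (i : 'I_N) (x : 'I_r) : word N r :=
  [ffun j => if j == i then x else w j].

Lemma update_id N r (w : word N r) i x : update w i x i = x.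
Proof. by rewrite ffunE eqxx. Qed.

Lemma update_neq N r (w : word N r) i x j : j != i -> update w i x j = w j.
Proof. by rewrite ffunE => /negPf->. Qed.

(** Swapping [w i] with a fresh letter [x] is an involution of the pairs
    (word, letter): resampling a letter does not change the uniform law.  This is
    the only form in which the independence of the letters is used. *)
Lemma sum_update (V : nmodType) N r (F : word N r -> V) i :
  \sum_w \sum_x F (update w i x) = (\sum_w F w) *+ r.
Proof.
rewrite pair_big /=.
pose h (p : word N r * 'I_r) := (update p.1 i p.2, p.1 i).
have hK : involutive h.
  move=> [w x]; rewrite /h /=; congr pair; last by rewrite update_id.
  by apply/ffunP => j; rewrite !ffunE; case: (eqVneq j i) => [->|].
rewrite (reindex_inj (inv_inj hK)) /=.
transitivity (\sum_(p : word N r * 'I_r) F p.1).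
  apply: eq_bigr => -[w x] _ /=; congr F; apply/ffunP => j.
  by rewrite !ffunE; case: (eqVneq j i) => [->|].
rewrite -(pair_big xpredT xpredT (fun w _ => F w)) /= -sumrMnl.
by apply: eq_bigr => w _; rewrite sumr_const card_ord.
Qed.

Section avg_theory.
Variables (R : numFieldType) (N p : nat).
Local Notation r := p.+1.
Implicit Types (F G : word N r -> R) (c : R).

Lemma eq_avg F G : F =1 G -> avg F = avg G.
Proof. by move=> FG; congr (_ * _); apply: eq_bigr => w _. Qed.

Lemma avgD F G : avg (fun w => F w + G w) = avg F + avg G.
Proof. by rewrite /avg big_split mulrDr. Qed.

Lemma avgZ c F : avg (fun w => c * F w) = c * avg F.
Proof. by rewrite /avg -mulr_sumr mulrCA. Qed.

Lemma avgB F G : avg (fun w => F w - G w) = avg F - avg G.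
Proof. by rewrite /avg sumrB mulrBr. Qed.

Lemma avg_sum (I : finType) (P : pred I) (F : I -> word N r -> R) :
  avg (fun w => \sum_(i | P i) F i w) = \sum_(i | P i) avg (F i).
Proof. by rewrite /avg exchange_big mulr_sumr. Qed.

Lemma avg_cst c : avg (fun _ : word N r => c) = c.
Proof.
rewrite /avg sumr_const card_ffun !card_ord -[c *+ _]mulr_natl natrX mulrA.
by rewrite mulVf ?mul1r// expf_neq0// pnatr_eq0.
Qed.

Lemma avg_le F G : (forall w, F w <= G w) -> avg F <= avg G.
Proof.
move=> FG; rewrite /avg ler_wpM2l// ?invr_ge0 ?exprn_ge0 ?ler0n//.
exact: ler_sum.
Qed.

Lemma avg_norm F : `|avg F| <= avg (fun w => `|F w|).
Proof.
rewrite /avg normrM ger0_norm ?invr_ge0 ?exprn_ge0 ?ler0n//.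
by rewrite ler_wpM2l// ?ler_norm_sum// invr_ge0 exprn_ge0.
Qed.

Lemma avg_update F i : avg F = avg (fun w => r%:R^-1 * \sum_x F (update w i x)).
Proof.
rewrite avgZ /avg sum_update -[(\sum_w _) *+ _]mulr_natl mulrCA.
by rewrite mulKf ?pnatr_eq0.
Qed.

(** If the average over one letter, the others being fixed, is a constant, that
    constant is the expectation. *)
Lemma avg_update_cst F i c :
  (forall w, \sum_x F (update w i x) = c *+ r) -> avg F = c.
Proof.
move=> Fc; rewrite (avg_update F i) -[RHS]avg_cst /avg; congr (_ * _).
apply: eq_bigr => w _; by rewrite Fc -[c *+ _]mulr_natl mulKf ?pnatr_eq0.
Qed.

End avg_theory.

(** * Galois numbers count words by inversions *)

Section mahonian.
Variable F : fieldType.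

Definition has_content N r (k : 'I_r -> nat) (w : word N r) : bool :=
  [forall j, \sum_(i < N) (w i == j) == k j]%N.

Lemma qnat_sum_ord r (k : 'I_r -> nat) : qnat F (\sum_j k j)%N =
  \sum_(x < r) 'X^(\sum_(j < r | (j < x)%N) k j)%N * qnat F (k x).
Proof.
elim: r k => [|r IH] k; first by rewrite !big_ord0 qnatE big_ord0.
rewrite big_ord_recr /= qnatD IH big_ord_recr /=; congr (_ + _).
  apply: eq_bigr => x _; congr ('X^_ * _).
  rewrite [RHS]big_mkcond big_ord_recr /= [LHS]big_mkcond.
  by rewrite (ltnNge r) (ltnW (ltn_ord x)) addn0.
congr ('X^_ * _); rewrite [RHS]big_mkcond big_ord_recr /= ltnn addn0.
by apply: eq_bigr => j _; rewrite ltn_ord.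
Qed.

Lemma qnat_neq0 n : (0 < n)%N -> qnat F n != 0.
Proof.
case: n => // n _; rewrite qnatE; apply/eqP => /(congr1 (fun P : {poly F} => P`_0)).
rewrite coef_sum coef0 big_ord_recl big1 ?addr0 => [|i _].
  by rewrite expr0 coefC /= => /eqP; rewrite oner_eq0.
by rewrite coefXn.
Qed.

Lemma qfact_neq0 n : qfact F n != 0.
Proof.
elim: n => [|n IH]; first by rewrite /qfact big_nil oner_neq0.
by rewrite qfactS mulf_neq0// qnat_neq0.
Qed.

(** MacMahon's theorem on the inversions of the rearrangements of a multiset,
    by induction on the length: a first letter [x] creates an inversion with each
    smaller letter that follows, and the recursion so obtained for the sum over
    words is the decomposition of [qnat (\sum_j k j)] in [qnat_sum_ord]. *)
Lemma qmultinomial_words N r (k : 'I_r -> nat) : (\sum_j k j)%N = N ->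
  (\prod_j qfact F (k j)) * \sum_(w : word N r | has_content k w) 'X^(inversions w)
  = qfact F N.
Proof.
elim: N k => [|N IH] k kN.
  have k0 j : k j = 0%N.
    by apply/eqP; move/eqP: kN; rewrite sum_nat_eq0 => /forallP/(_ j)/implyP; apply.
  rewrite big1 => [|j _]; last by rewrite k0 /qfact big_nil.
  pose w0 : word 0 r := ffun0 (card_ord 0).
  rewrite mul1r (bigD1 w0) /=; last by apply/forallP => j; rewrite big_ord0 k0.
  rewrite big1 => [|w /andP[_ /eqP[]]]; last by apply/ffunP => -[].
  by rewrite addr0 /inversions big_ord0 /qfact big_nil.
have qN := qnat_sum_ord k; rewrite kN in qN.
rewrite sum_word_cons mulr_sumr qfactS qN mulr_sumr {qN}.
apply: eq_bigr => x _.
have [kx0|kx_gt0] := posnP (k x).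
  rewrite [\sum_(w | _) _]big_pred0 ?mulr0 => [|w].
    by rewrite kx0 qnatE big_ord0 !mulr0.
  apply/negbTE/negP => /forallP/(_ x).
  by rewrite kx0 big_ord_recl word_cons0 eqxx add1n.
(* the content that is left to the word once its first letter is removed *)
pose k' j := if j == x then (k x).-1 else k j.
have k'E j : (k j = (j == x) + k' j)%N.
  by rewrite /k' eq_sym; case: eqVneq => [<-|]//; rewrite add1n prednK.
have k'N : (\sum_j k' j)%N = N.
  move: kN; under eq_bigr do rewrite k'E; rewrite big_split /=.
  by rewrite (bigD1 x)//= eqxx big1 ?addn0 => [[]//|j /negPf ->].
have contentE (w : word N r) : has_content k (word_cons x w) = has_content k' w.
  apply: eq_forallb => j; rewrite big_ord_recl word_cons0 k'E (eq_sym j) eqn_add2l.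
  by under eq_bigr do rewrite word_consS.
have invE (w : word N r) : has_content k' w ->
    inversions (word_cons x w) = (\sum_(j < r | (j < x)%N) k j + inversions w)%N.
  move=> /forallP kw; rewrite inversions_cons; congr addn.
  rewrite [RHS](eq_bigr (fun j : 'I_r => \sum_(i < N) (w i == j))%N) => [|j jx].
    rewrite exchange_big /=; apply: eq_bigr => i _.
    rewrite big_mkcond (bigD1 (w i))//= eqxx big1 ?addn0; first by case: ifP.
    by move=> j; rewrite eq_sym => /negPf ->; case: ifP.
  by rewrite (eqP (kw j)) /k' -val_eqE /= ltn_eqF.
have -> : \sum_(w : word N r | has_content k (word_cons x w))
      'X^(inversions (word_cons x w)) =
    'X^(\sum_(j < r | (j < x)%N) k j)%N *
      \sum_(w : word N r | has_content k' w) 'X^(inversions w) :> {poly F}.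
  rewrite mulr_sumr; apply: eq_big => [w|w kw]; first exact: contentE.
  by rewrite invE -?contentE// exprD.
have -> : \prod_j qfact F (k j) = qnat F (k x) * \prod_j qfact F (k' j).
  rewrite (bigD1 x)//= [in RHS](bigD1 x)//= [k' x]/k' eqxx.
  rewrite -[in LHS](prednK kx_gt0) qfactS prednK// [_ * qnat _ _]mulrC -mulrA.
  congr (_ * (_ * _)); apply: eq_bigr => j /negPf jx.
  by rewrite /k' jx.
by rewrite -(IH k' k'N); ring.
Qed.

Lemma galois_numberE r N :
  galois_number F r N = \sum_(w : word N r) 'X^(inversions w).
Proof.
pose content (w : word N r) : {ffun 'I_r -> 'I_N.+1} :=
  [ffun j => inord (\sum_(i < N) (w i == j))%N].
have content_lt (w : word N r) j : (\sum_(i < N) (w i == j) < N.+1)%N.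
  rewrite ltnS -[leqRHS](card_ord N) -sum1_card leq_sum// => i _.
  by case: eqP.
rewrite (partition_big content xpredT)//=; apply: eq_bigr => k _.
rewrite (eq_bigl (has_content (fun j => k j : nat))); last first.
  move=> w; apply/eqP/forallP => [<- j|kw].
    by rewrite ffunE inordK// content_lt.
  by apply/ffunP => j; rewrite ffunE (eqP (kw j)) inord_val.
rewrite /qmultinomial; case: eqVneq => [kN|kN].
  rewrite -(qmultinomial_words kN) mulrC mulpK//.
  by apply/prodf_neq0 => j _; exact: qfact_neq0.
rewrite big_pred0// => w; apply/negbTE/negP => /forallP kw.
case/eqP: kN; under eq_bigr => j _ do rewrite -(eqP (kw j)).
rewrite exchange_big /= -[RHS](card_ord N) -sum1_card; apply: eq_bigr => i _.
by rewrite (bigD1 (w i))//= eqxx big1// => j; rewrite eq_sym => /negPf ->.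
Qed.

End mahonian.

(** * The orthogonal decomposition of the number of inversions *)

Section hoeffding.
Variables (R : realFieldType) (p : nat).
Local Notation r := p.+1.

(** The letters are [0, ..., p]; the score is the centred letter, scaled so that
    its values are spaced by [1 / r]. *)
Definition score (x : 'I_r) : R := (x%:R - p%:R / 2) / r%:R.

(** The variance of the score of a uniformly random letter. *)
Definition score_var : R := (r%:R ^+ 2 - 1) / (12 * r%:R ^+ 2).

Let r_neq0 : 1 + p%:R != 0 :> R.
Proof. by rewrite addrC natr1 pnatr_eq0. Qed.

Lemma sum_natr n : \sum_(i < n) i%:R = n%:R * (n%:R - 1) / 2 :> R.
Proof.
elim: n => [|n IH]; first by rewrite big_ord0 !mul0r.
by rewrite big_ord_recr /= IH -natr1; field.
Qed.

Lemma sum_sqr_affine n (a b : R) : \sum_(i < n) (a + b * i%:R) ^+ 2 =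
  n%:R * a ^+ 2 + a * b * n%:R * (n%:R - 1)
  + b ^+ 2 * n%:R * (n%:R - 1) * (2 * n%:R - 1) / 6.
Proof.
elim: n => [|n IH]; first by rewrite big_ord0 !(mul0r, mulr0, addr0).
by rewrite big_ord_recr /= IH -natr1; field.
Qed.

Lemma sum_score : \sum_x score x = 0.
Proof.
rewrite -mulr_suml sumrB sum_natr sumr_const card_ord.
rewrite -[p%:R / 2 *+ _]mulr_natl; field; exact: r_neq0.
Qed.

Lemma sum_score_sqr : \sum_x score x ^+ 2 = score_var *+ r.
Proof.
have E x : score x ^+ 2 = (- (p%:R / 2) + 1 * x%:R) ^+ 2 / r%:R ^+ 2.
  by rewrite /score expr_div_n mul1r addrC.
rewrite (eq_bigr _ (fun x _ => E x)) -mulr_suml sum_sqr_affine /score_var.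
by rewrite -[RHS]mulr_natl; field; exact: r_neq0.
Qed.

Lemma normr_score_le x : `|score x| <= 1 / 2.
Proof.
have := ltn_ord x; rewrite ltnS -(ler_nat R) => xp.
rewrite normrM [`|_^-1|]ger0_norm ?invr_ge0// ler_pdivrMr ?ltr0Sn//.
rewrite (_ : r%:R = p%:R + 1) ?natr1// ler_norml; have := ler0n R x => x0.
by apply/andP; split; lra.
Qed.

Lemma score_var_ge0 : 0 <= score_var.
Proof.
rewrite divr_ge0 ?mulr_ge0 ?exprn_ge0 ?ler0n// subr_ge0 -natrX ler1n.
by rewrite expn_gt0.
Qed.

Lemma val_subZp (x y : 'I_r) :
  (y - x : 'I_r) = (if (x <= y)%N then y - x else y + r - x)%N :> nat.
Proof.
rewrite /= modnDmr; have [xr yr] := (ltn_ord x, ltn_ord y); case: leqP => xy.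
  by rewrite addnBA ?(ltnW xr)// addnC -addnBA// modnDl modn_small; lia.
by rewrite addnBA ?(ltnW xr)// modn_small; lia.
Qed.

(** The Hoeffding decomposition of the kernel [y < x].  The difference [y - x] is
    taken in [Z/r], so the last term is a score again: its representative is
    [y - x] or [y - x + r], and the jump is the indicator on the left. *)
Lemma descent_decomposition (x y : 'I_r) :
  (y < x)%N%:R - p%:R / (2 * r%:R) = score x - score y + score (y - x).
Proof.
rewrite /score val_subZp; case: leqP => xy.
  by rewrite natrB// mulr0n; field; exact: r_neq0.
rewrite natrB ?natrD; last by have := ltn_ord x; lia.
by rewrite mulr1n; field; exact: r_neq0.
Qed.

Lemma sum_score_subl (y : 'I_r) (h : R -> R) :
  \sum_x h (score (y - x)) = \sum_x h (score x).
Proof. by rewrite [RHS](reindex_inj (subrI y)). Qed.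

Lemma sum_score_subr (y : 'I_r) (h : R -> R) :
  \sum_x h (score (x - y)) = \sum_x h (score x).
Proof. by rewrite [RHS](reindex_inj (addIr (- y))). Qed.

Variable N : nat.
Implicit Types (w : word N r) (F : word N r -> R).

(** The number of positions after [i] minus the number of positions before it. *)
Definition weight (i : 'I_N) : R := N%:R - 1 - 2 * i%:R.

(** The projection of the number of inversions on sums of functions of single
    letters; it is asymptotically dominant. *)
Definition linear_part w : R := \sum_i weight i * score (w i).

(** The remainder of the projection: each term is centred conditionally on either
    of its two letters. *)
Definition degenerate_part w : R :=
  \sum_(q : 'I_N * 'I_N | (q.1 < q.2)%N) score (w q.2 - w q.1).

Definition mean_inversions : R := p%:R / (4 * r%:R) * N%:R * (N%:R - 1).

Lemma sum_lt_ord (i : 'I_N) : \sum_(j < N) (j < i)%N%:R = i%:R :> R.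
Proof.
rewrite -natr_sum; congr _%:R.
have E n k : (\sum_(j < n) (j < k) = minn k n)%N.
  by elim: n => [|n IH]; rewrite ?big_ord0 ?big_ord_recr /= ?IH; lia.
by rewrite E; have := ltn_ord i; lia.
Qed.

Lemma sum_gt_ord (i : 'I_N) :
  \sum_(j < N) (i < j)%N%:R = N%:R - 1 - i%:R :> R.
Proof.
have : \sum_(j < N) ((j < i)%N%:R + (i < j)%N%:R + (j == i)%:R) = N%:R :> R.
  rewrite -[in RHS](card_ord N) -sum1_card natr_sum; apply: eq_bigr => j _.
  by rewrite -val_eqE /=; case: ltngtP; rewrite ?add0r ?addr0.
have -> : \sum_(j < N) ((j < i)%N%:R + (i < j)%N%:R + (j == i)%:R) =
    i%:R + \sum_(j < N) (i < j)%N%:R + 1 :> R.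
  rewrite !big_split /= sum_lt_ord; congr (_ + _).
  by rewrite (bigD1 i)//= eqxx big1 ?addr0// => j /negPf ->.
lra.
Qed.

Lemma inversions_decomposition w :
  (inversions w)%:R - mean_inversions = linear_part w + degenerate_part w.
Proof.
have pairE (h : 'I_N -> 'I_N -> R) :
    \sum_(q : 'I_N * 'I_N | (q.1 < q.2)%N) h q.1 q.2 =
    \sum_(i < N) \sum_(j < N) (i < j)%N%:R * h i j.
  rewrite -(pair_big_dep xpredT (fun i j : 'I_N => (i < j)%N)) /=.
  apply: eq_bigr => i _; rewrite big_mkcond; apply: eq_bigr => j _.
  by case: ifP; rewrite ?mul1r ?mul0r.
have -> : linear_part w =
    \sum_(q : 'I_N * 'I_N | (q.1 < q.2)%N) (score (w q.1) - score (w q.2)).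
  rewrite (pairE (fun i j => score (w i) - score (w j))).
  under eq_bigr do under eq_bigr do rewrite mulrBr.
  under eq_bigr do rewrite sumrB -mulr_suml sum_gt_ord.
  rewrite sumrB exchange_big /= -sumrB; apply: eq_bigr => i _.
  by rewrite -mulr_suml sum_lt_ord /weight; ring.
rewrite /degenerate_part -big_split /=.
rewrite (pairE (fun i j => score (w i) - score (w j) + score (w j - w i))).
under [RHS]eq_bigr do under eq_bigr do rewrite -descent_decomposition mulrBr.
under [RHS]eq_bigr do rewrite sumrB -mulr_suml sum_gt_ord.
rewrite sumrB -mulr_suml; congr (_ - _).
  rewrite /inversions natr_sum; apply: eq_bigr => i _.
  rewrite natr_sum; apply: eq_bigr => j _.
  by rewrite -natrM mulnb.
rewrite sumrB sumr_const card_ord sum_natr /mean_inversions.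
by rewrite -[(_ - _) *+ N]mulr_natl; field; exact: r_neq0.
Qed.

Lemma avg_score_eq0 i F : (forall w x, F (update w i x) = F w) ->
  avg (fun w => score (w i) * F w) = 0.
Proof.
move=> FE; apply: (avg_update_cst (i := i)) => w.
rewrite mul0rn; under eq_bigr do rewrite update_id FE.
by rewrite -mulr_suml sum_score mul0r.
Qed.

Lemma avg_score_sqr i F : (forall w x, F (update w i x) = F w) ->
  avg (fun w => score (w i) ^+ 2 * F w) = score_var * avg F.
Proof.
move=> FE; rewrite -avgZ (avg_update _ i) [RHS](avg_update _ i).
congr (_ * _); apply: eq_bigr => w _; congr (_ * _).
under eq_bigr do rewrite update_id FE.
under [RHS]eq_bigr do rewrite FE.
by rewrite -mulr_suml sum_score_sqr sumr_const card_ord mulrnAl.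
Qed.

(** A term of the degenerate part is orthogonal to every function that ignores one
    of its two letters, because [w j - w i] is uniform in [Z/r] when the other letter
    is fixed. *)
Lemma avg_score_sub_eq0 (i j k : 'I_N) F : i != j -> k \in [:: i; j] ->
  (forall w x, F (update w k x) = F w) ->
  avg (fun w => score (w j - w i) * F w) = 0.
Proof.
move=> ij kij FE; apply: (avg_update_cst (i := k)) => w.
rewrite mul0rn; under eq_bigr do rewrite FE.
rewrite -mulr_suml; move: kij; rewrite !inE => /orP[] /eqP ->.
  under eq_bigr do rewrite update_id update_neq 1?eq_sym//.
  by rewrite (sum_score_subl _ id) sum_score mul0r.
under eq_bigr do rewrite update_id update_neq//.
by rewrite (sum_score_subr _ id) sum_score mul0r.
Qed.

Lemma avg_score_sub_sqr (i j : 'I_N) : i != j ->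
  avg (fun w => score (w j - w i) ^+ 2) = score_var.
Proof.
move=> ij; apply: (avg_update_cst (i := j)) => w.
under eq_bigr do rewrite update_id update_neq//.
by rewrite (sum_score_subr _ (fun t => t ^+ 2)) sum_score_sqr.
Qed.

Lemma avg_linear_part : avg linear_part = 0.
Proof.
rewrite avg_sum big1// => i _; rewrite avgZ.
have := @avg_score_eq0 i (fun _ => 1) (fun _ _ => erefl).
by rewrite /avg; under eq_bigr do rewrite mulr1; move=> ->; rewrite mulr0.
Qed.

Lemma avg_degenerate_part : avg degenerate_part = 0.
Proof.
rewrite avg_sum big1// => -[i j] /= ij.
have := @avg_score_sub_eq0 i j i (fun _ => 1).
rewrite /avg; under eq_bigr do rewrite mulr1; apply=> //.
  by rewrite -val_eqE /= ltn_eqF.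
by rewrite inE eqxx.
Qed.

Lemma avg_inversions : avg (fun w => (inversions w)%:R) = mean_inversions.
Proof.
have -> : avg (fun w => (inversions w)%:R) =
    avg (fun w => mean_inversions + (linear_part w + degenerate_part w)).
  by apply: eq_avg => w; rewrite -inversions_decomposition subrKC.
by rewrite avgD avg_cst avgD avg_linear_part avg_degenerate_part !addr0.
Qed.

Lemma sum_weight_sqr : \sum_i weight i ^+ 2 = N%:R * (N%:R ^+ 2 - 1) / 3.
Proof.
rewrite (eq_bigr (fun i : 'I_N => ((N%:R - 1) + (- 2) * i%:R) ^+ 2)).
  by rewrite sum_sqr_affine; field.
by move=> i _; rewrite /weight mulNr.
Qed.

Lemma avg_linear_part_sqr : avg (fun w => linear_part w ^+ 2) =
  score_var * (N%:R * (N%:R ^+ 2 - 1) / 3).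
Proof.
rewrite -sum_weight_sqr.
have -> : avg (fun w => linear_part w ^+ 2) = avg (fun w =>
    \sum_i weight i * (\sum_j weight j * (score (w i) * score (w j)))).
  apply: eq_avg => w.
  rewrite expr2 {1}/linear_part mulr_suml; apply: eq_bigr => i _.
  rewrite -mulrA; congr (_ * _); rewrite /linear_part mulr_sumr.
  by apply: eq_bigr => j _; rewrite mulrCA.
rewrite avg_sum mulr_sumr; apply: eq_bigr => i _; rewrite avgZ avg_sum.
rewrite (bigD1 i)//= big1 ?addr0 => [|j ji]; rewrite avgZ; last first.
  rewrite avg_score_eq0 ?mulr0// => w x.
  by rewrite update_neq.
have := @avg_score_sqr i (fun _ => 1) (fun _ _ => erefl).
rewrite avg_cst mulr1 /avg; under eq_bigr do rewrite mulr1 expr2.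
by move=> ->; rewrite mulrA mulrC expr2.
Qed.

Lemma avg_degenerate_part_sqr : avg (fun w => degenerate_part w ^+ 2) =
  score_var * (N%:R * (N%:R - 1) / 2).
Proof.
have -> : N%:R * (N%:R - 1) / 2 =
    \sum_(q : 'I_N * 'I_N | (q.1 < q.2)%N) 1 :> R.
  rewrite -(pair_big_dep xpredT (fun i j : 'I_N => (i < j)%N) (fun _ _ => 1)) /=.
  rewrite -sum_natr (exchange_big_dep xpredT)//=; apply: eq_bigr => j _.
  by rewrite -sum_lt_ord [RHS]big_mkcond /=; apply: eq_bigr => i _; case: ltnP.
have -> : avg (fun w => degenerate_part w ^+ 2) = avg (fun w =>
    \sum_(q : 'I_N * 'I_N | (q.1 < q.2)%N)
    \sum_(q' : 'I_N * 'I_N | (q'.1 < q'.2)%N)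
       score (w q.2 - w q.1) * score (w q'.2 - w q'.1)).
  apply: eq_avg => w; rewrite expr2 /degenerate_part mulr_suml.
  by apply: eq_bigr => q _; rewrite mulr_sumr.
rewrite avg_sum mulr_sumr; apply: eq_bigr => -[i j] /= ij; rewrite avg_sum.
have ijN : i != j by rewrite -val_eqE /= ltn_eqF.
rewrite (bigD1 (i, j))//= big1 ?addr0 => [|[k l] /= /andP[kl]].
  by rewrite mulr1 -(avg_score_sub_sqr ijN).
rewrite xpair_eqE => klij.
(* distinct increasing pairs: one position of the first is not in the second *)
have [m mij /andP[mk ml]] : exists2 m, m \in [:: i; j] & (m != k) && (m != l).
  have [ik|ik] := boolP ((i != k) && (i != l)).
    by exists i => //; rewrite inE eqxx.
  exists j; first by rewrite !inE eqxx orbT.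
  move: ik klij ij kl; rewrite !negb_and !negbK -!val_eqE /=; lia.
apply: (avg_score_sub_eq0 ijN mij) => w x.
by rewrite !update_neq// eq_sym.
Qed.

Lemma avg_linear_degenerate :
  avg (fun w => linear_part w * degenerate_part w) = 0.
Proof.
have -> : avg (fun w => linear_part w * degenerate_part w) = avg (fun w =>
    \sum_i weight i * (\sum_(q : 'I_N * 'I_N | (q.1 < q.2)%N)
      (score (w q.2 - w q.1) * score (w i)))).
  apply: eq_avg => w.
  rewrite mulr_suml; apply: eq_bigr => i _; rewrite -mulrA; congr (_ * _).
  by rewrite /degenerate_part mulr_sumr; apply: eq_bigr => q _; rewrite mulrC.
rewrite avg_sum big1// => i _; rewrite avgZ avg_sum big1 ?mulr0// => -[j k] /= jk.
have jkN : j != k by rewrite -val_eqE /= ltn_eqF.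
have [m mjk mi] : exists2 m, m \in [:: j; k] & i != m.
  have [ij|] := eqVneq i j; last by exists j => //; rewrite inE eqxx.
  by exists k; rewrite ?ij// !inE eqxx orbT.
by apply: (avg_score_sub_eq0 jkN mjk) => w x; rewrite update_neq.
Qed.

Definition var_inversions : R :=
  (r%:R - 1) * (r%:R + 1) / (72 * r%:R ^+ 2) * N%:R * (N%:R - 1) * (2 * N%:R + 5).

(** The variance is exact because the two parts, and the terms within each of them,
    are pairwise orthogonal. *)
Lemma avg_inversions_sqr :
  avg (fun w => ((inversions w)%:R - mean_inversions) ^+ 2) = var_inversions.
Proof.
have -> : avg (fun w => ((inversions w)%:R - mean_inversions) ^+ 2) =
    avg (fun w => linear_part w ^+ 2 + 2 * (linear_part w * degenerate_part w)
                  + degenerate_part w ^+ 2).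
  apply: eq_avg => w; rewrite inversions_decomposition.
  by rewrite sqrrD mulr_natl.
rewrite avgD avgD avgZ avg_linear_degenerate mulr0 addr0.
rewrite avg_linear_part_sqr avg_degenerate_part_sqr /score_var /var_inversions.
by field; exact: r_neq0.
Qed.

End hoeffding.

(** * Stein's method for the number of inversions *)

Section stein.
Variables (R : realFieldType) (p N : nat).
Local Notation r := p.+1.
Variables (a : 'I_N -> R) (b : R).
Hypothesis a_le : forall i, `|a i| <= b.
Variables (g g' : R -> R) (M e C : R).
(* The moduli are of the form [e + C * h ^+ 2] so that every error is controlled
   by second moments. *)
Hypothesis g'_bounded : forall x, `|g' x| <= M.
Hypothesis C_ge0 : 0 <= C.
Hypothesis g'_modulus : forall x h, `|g' (x + h) - g' x| <= e + C * h ^+ 2.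
Hypothesis g_taylor : forall x h,
  `|g (x + h) - g x - h * g' x| <= `|h| * (e + C * h ^+ 2).

Let S (w : word N r) : R := \sum_i a i * score R (w i).
Let eta : R := e + C * b ^+ 2.

Let shift_sqr_le i (w : word N r) : (a i * score R (w i)) ^+ 2 <= b ^+ 2.
Proof.
rewrite -real_normK ?num_real// lerXn2r ?nnegrE// ?(le_trans _ (a_le i))//.
rewrite normrM ler_piMr// (le_trans (normr_score_le _ _))//; lra.
Qed.

(** Remove the contribution of the letter [i] from [S]: what is left, [T], does
    not depend on that letter, so the term of order 0 in the expansion of [g (S w)]
    around [T w] vanishes on average and the term of order 1 is [a i] times the
    variance of the score. *)
Let stein_term i : `|avg (fun w => score R (w i) * g (S w)) -
    a i * score_var R p * avg (fun w => g' (S w))| <=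
  `|a i| * score_var R p * (2 * eta).
Proof.
pose T w := S w - a i * score R (w i).
have TE w x : T (update w i x) = T w.
  rewrite /T /S (bigD1 i)//= [in RHS](bigD1 i)//=.
  rewrite addrAC subrr add0r [RHS]addrAC subrr add0r.
  by apply: eq_bigr => j ji; rewrite update_neq.
have ST w : S w = T w + a i * score R (w i) by rewrite subrK.
have v_ge0 := score_var_ge0 R p.
pose rem (w : word N r) := score R (w i) * g (S w) - score R (w i) * g (T w)
              - a i * (score R (w i) ^+ 2 * g' (T w)).
have remE : avg rem = avg (fun w => score R (w i) * g (S w))
                      - a i * score_var R p * avg (fun w => g' (T w)).
  rewrite /rem 2!avgB avgZ (avg_score_eq0 (F := fun w => g (T w))) => [|w x]; last by rewrite TE.
  rewrite (avg_score_sqr (F := fun w => g' (T w))) => [|w x]; last by rewrite TE.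
  by rewrite subr0 mulrA.
have rem_le : `|avg rem| <= `|a i| * score_var R p * eta.
  have sE := @avg_score_sqr R p N i (fun _ => 1) (fun _ _ => erefl).
  rewrite avg_cst mulr1 in sE.
  rewrite (le_trans (avg_norm _))// -sE mulrAC -avgZ; apply: avg_le => w.
  have -> : rem w = score R (w i) * (g (T w + a i * score R (w i)) - g (T w)
              - a i * score R (w i) * g' (T w)).
    by rewrite /rem ST; ring.
  rewrite normrM mulr1 -[score R (w i) ^+ 2]real_normK ?num_real//.
  apply: (@le_trans _ _ (`|score R (w i)| * (`|a i * score R (w i)| * eta))).
    rewrite ler_wpM2l// (le_trans (g_taylor _ _))// ler_wpM2l//.
    by rewrite lerD2l ler_wpM2l.
  rewrite [`|a i * _|]normrM le_eqVlt; apply/orP; left; apply/eqP; ring.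
have TS : `|avg (fun w => g' (T w)) - avg (fun w => g' (S w))| <= eta.
  rewrite distrC -avgB (le_trans (avg_norm _))//.
  rewrite -[leRHS](avg_cst N p); apply: avg_le => w.
  by rewrite ST (le_trans (g'_modulus _ _))// lerD2l ler_wpM2l.
set x := avg _; set y := avg (fun w => g' (S w)).
have -> : x - a i * score_var R p * y =
    avg rem + a i * score_var R p * (avg (fun w => g' (T w)) - y).
  by rewrite remE /x; ring.
rewrite (le_trans (ler_normD _ _))// mulr_natl mulrnAr mulr2n lerD//.
by rewrite normrM ler_pM// normrM [`|score_var R p|]ger0_norm.
Qed.

(** A normal variable [Z] of variance 1 is characterized by
    [E (g' Z - Z * g Z) = 0]; a weighted sum of small independent centred terms
    whose variance is close to 1 satisfies this equation approximately. *)
Lemma stein_weighted_sum :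
  `|avg (fun w => g' (S w) - S w * g (S w))| <=
  `|1 - score_var R p * \sum_i a i ^+ 2| * M
  + score_var R p * (\sum_i a i ^+ 2) * (2 * eta).
Proof.
have v_ge0 := score_var_ge0 R p.
set s2 := \sum_i _.
have M_ge0 : 0 <= M by rewrite (le_trans _ (g'_bounded 0)).
set y := avg (fun w => g' (S w)).
have SgE : avg (fun w => S w * g (S w)) =
    \sum_i a i * avg (fun w => score R (w i) * g (S w)).
  have -> : avg (fun w => S w * g (S w)) =
      avg (fun w => \sum_i a i * (score R (w i) * g (S w))).
    apply: eq_avg => w; rewrite mulr_suml.
    by apply: eq_bigr => i _; rewrite mulrA.
  by rewrite avg_sum; apply: eq_bigr => i _; rewrite avgZ.
have -> : avg (fun w => g' (S w) - S w * g (S w)) =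
    (1 - score_var R p * s2) * y
    - \sum_i a i * (avg (fun w => score R (w i) * g (S w))
                    - a i * score_var R p * y).
  rewrite avgB SgE -/y mulrBl mul1r.
  under [in RHS]eq_bigr do rewrite mulrBr.
  rewrite sumrB; set X := \sum_i a i * avg _.
  have -> : \sum_i a i * (a i * score_var R p * y) = score_var R p * s2 * y.
    by rewrite /s2 mulr_sumr mulr_suml; apply: eq_bigr => i _; ring.
  ring.
rewrite (le_trans (ler_normB _ _))// lerD//.
  rewrite normrM ler_wpM2l// (le_trans (avg_norm _))//.
  by rewrite -[leRHS](avg_cst N p); exact: avg_le.
rewrite (le_trans (ler_norm_sum _ _ _))// mulrAC mulrC.
rewrite mulr_suml; apply: ler_sum => i _.
rewrite normrM -[a i ^+ 2]real_normK ?num_real//.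
rewrite (le_trans (ler_wpM2l (normr_ge0 _) (stein_term i)))//.
by rewrite expr2 !mulrA.
Qed.
End stein.

Section stein_inversions.
Variables (R : realFieldType) (p N : nat).
Local Notation r := p.+1.
Hypotheses (p_gt0 : (0 < p)%N) (N_ge2 : (2 <= N)%N).
Variables (g g' : R -> R) (M e C : R).
Hypothesis g'_bounded : forall x, `|g' x| <= M.
Hypothesis C_ge0 : 0 <= C.
Hypothesis g'_modulus : forall x h, `|g' (x + h) - g' x| <= e + C * h ^+ 2.
Hypothesis g_taylor : forall x h,
  `|g (x + h) - g x - h * g' x| <= `|h| * (e + C * h ^+ 2).
Let k x := g' x - x * g x.
Hypothesis k_modulus : forall x h, `|k (x + h) - k x| <= e + C * h ^+ 2.
Variable sigma : R.
Hypotheses (sigma_gt0 : 0 < sigma) (sigmaE : sigma ^+ 2 = var_inversions R p N).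

Let n1 : 1 <= N%:R - 1 :> R.
Proof. by rewrite lerBrDr (_ : 1 + 1 = 2%:R)// ler_nat. Qed.

Let r1 : 2 <= r%:R :> R.
Proof. by rewrite ler_nat. Qed.

Let r_neq0 : 1 + p%:R != 0 :> R.
Proof. by rewrite addrC natr1 pnatr_eq0. Qed.

Let N5_gt0 : 0 < 2 * N%:R + 5 :> R.
Proof. by have := ler0n R N; lra. Qed.

(** The variance has order [N ^+ 3] uniformly in [r >= 2], as [1 - r ^- 2 >= 3 / 4]. *)
Let var_ge : N%:R * (N%:R - 1) * (2 * N%:R + 5) / 96 <= sigma ^+ 2.
Proof.
have -> : sigma ^+ 2 = (r%:R ^+ 2 - 1) / (72 * r%:R ^+ 2) *
    (N%:R * (N%:R - 1) * (2 * N%:R + 5)).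
  by rewrite sigmaE /var_inversions; field; exact: r_neq0.
rewrite [leRHS]mulrC; apply: ler_wpM2l.
  by rewrite !mulr_ge0// ?ltW//; have := n1; lra.
have r2 : 4 <= r%:R ^+ 2 :> R.
  by rewrite (_ : 4 = 2 ^+ 2) ?lerXn2r ?nnegrE//; ring.
by rewrite ler_pdivlMr; have := r2; lra.
Qed.

(** The weights are at most [(N - 1) / sigma], which is of order [N ^- (1/2)], and the
    degenerate part carries the share [3 / (2 * N + 5)] of the variance: both kinds
    of error are bounded by a multiple of [(2 * N + 5)^-1].  The constant 195 is
    [3 + 2 * 96]: 3 from the degenerate part, and 96, from the bound on the squared
    weights, for each of the two errors in [stein_term]. *)
Lemma stein_inversions :
  `|avg (fun w : word N r => k (((inversions w)%:R - mean_inversions R p N) / sigma))| <=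
  3 * e + (3 * M + 195 * C) / (2 * N%:R + 5).
Proof.
pose a (i : 'I_N) := weight R i / sigma.
pose S (w : word N r) := \sum_i a i * score R (w i).
pose b := (N%:R - 1) / sigma.
have e_ge0 : 0 <= e.
  by have := k_modulus 0 0; rewrite addr0 subrr normr0 expr0n mulr0 addr0.
have := (n1, r1, N5_gt0) => -[[N1 r2 N5]].
have sigma2_gt0 : 0 < sigma ^+ 2 by rewrite exprn_gt0.
have SE w : S w = linear_part R w / sigma.
  by rewrite /linear_part mulr_suml; apply: eq_bigr => i _; rewrite mulrAC.
have a_le i : `|a i| <= b.
  rewrite /a normrM [`|sigma^-1|]ger0_norm ?invr_ge0 ?(ltW sigma_gt0)//.
  rewrite ler_wpM2r ?invr_ge0 ?(ltW sigma_gt0)//.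
  have : i.+1%:R <= N%:R :> R by rewrite ler_nat.
  rewrite -natr1 /weight ler_norml => iN; have := ler0n R i => i0.
  by apply/andP; split; lra.
have b_le : b ^+ 2 <= 96 / (2 * N%:R + 5).
  rewrite expr_div_n ler_pdivrMr// mulrAC ler_pdivlMr//.
  apply: (@le_trans _ _ (N%:R * (N%:R - 1) * (2 * N%:R + 5))); last first.
    by have := var_ge; lra.
  by rewrite ler_wpM2r ?(ltW N5_gt0)// expr2 ler_wpM2r//; lra.
have p1 : 1 <= p%:R :> R by rewrite ler1n.
have nz : [&& 2 * N%:R + 5 != 0 :> R, 1 + p%:R != 0 :> R, N%:R - 1 != 0 :> R,
     N%:R != 0 :> R, 1 + p%:R + 1 != 0 :> R & 1 + p%:R - 1 != 0 :> R].
  by rewrite !gt_eqF//; lra.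
have s2E : score_var R p * \sum_i a i ^+ 2 = 1 - 3 / (2 * N%:R + 5).
  have -> : \sum_i a i ^+ 2 = (N%:R * (N%:R ^+ 2 - 1) / 3) / sigma ^+ 2.
    rewrite -sum_weight_sqr mulr_suml; apply: eq_bigr => i _.
    by rewrite expr_div_n.
  rewrite sigmaE /score_var /var_inversions; field.
  exact: nz.
have DE : avg (fun w : word N r => (degenerate_part R w / sigma) ^+ 2) =
    3 / (2 * N%:R + 5).
  have -> : avg (fun w : word N r => (degenerate_part R w / sigma) ^+ 2) =
      avg (fun w : word N r => (sigma ^+ 2)^-1 * degenerate_part R w ^+ 2).
    by apply: eq_avg => w; rewrite expr_div_n mulrC.
  rewrite avgZ avg_degenerate_part_sqr sigmaE /score_var /var_inversions; field.
  exact: nz.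
have N5_ge0 : 0 <= 3 / (2 * N%:R + 5) :> R by rewrite divr_ge0// ltW.
have := stein_weighted_sum p a_le g'_bounded C_ge0 g'_modulus g_taylor.
rewrite s2E -/S => stein.
set A := avg _; set B := avg (fun w : word N r => k (S w)).
have AB : `|A - B| <= e + C * (3 / (2 * N%:R + 5)).
  rewrite /A /B -avgB (le_trans (avg_norm _))// -DE -[in leRHS]avgZ.
  rewrite -[X in _ <= X + _](avg_cst N p) -avgD; apply: avg_le => w.
  rewrite inversions_decomposition mulrDl -SE; exact: k_modulus.
have -> : A = (A - B) + B by rewrite subrK.
rewrite (le_trans (ler_normD _ _))// (le_trans (lerD AB stein))//.
have -> : 1 - (1 - 3 / (2 * N%:R + 5)) = 3 / (2 * N%:R + 5) :> R by ring.
rewrite ger0_norm//; move: b_le N5_ge0.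
set t := (2 * N%:R + 5)^-1 => b_le t_ge0.
have eta_ge0 : 0 <= e + C * b ^+ 2 by rewrite addr_ge0// mulr_ge0// sqr_ge0.
have : (1 - 3 * t) * (2 * (e + C * b ^+ 2)) <= 1 * (2 * (e + C * b ^+ 2)).
  by apply: ler_wpM2r; lra.
have : C * b ^+ 2 <= C * (96 * t) by rewrite ler_wpM2l.
by lra.
Qed.
End stein_inversions.

(** * From the generating function to the law *)

Lemma eq0_small (R : realFieldType) (x : R) :
  (forall q, 0 < q <= 1 -> `|x| <= q) -> x = 0.
Proof.
move=> h; apply/eqP; rewrite -normr_le0 leNgt; apply/negP => x0.
have := h (Num.min (`|x| / 2) 1); rewrite lt_min ge_min lexx orbT andbT ltr01.
rewrite divr_gt0// => /(_ isT); rewrite le_min => /andP[+ _]; lra.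
Qed.

Section law.
Context d (T : measurableType d) (R : realType) (P : probability T R).
Variable X : {RV P >-> nat}.

Let bounded_int (f : nat -> R) (M : R) : (forall n, `|f n| <= M) ->
  P.-integrable setT (EFin \o (fun w => f (X w))).
Proof.
move=> fM; apply: measurable_bounded_integrable => //.
- exact: (le_lt_trans (probability_le1 P measurableT) (ltry 1)).
- by apply: measurableT_comp => //; exact: measurable_funPT.
- exists M; split; first exact: num_real.
  by move=> x Mx w _ /=; rewrite (le_trans (fM _))// ltW.
Qed.

Let E (f : nat -> R) : R := \int[P]_w f (X w).

Let E_cst c : E (fun _ => c) = c.
Proof. by rewrite /E Rintegral_cst//= [X in fine X](probability_setT P) mulr1. Qed.

Let cst_int c := @bounded_int (fun _ => c) `|c| (fun _ => lexx _).

Let ind (k n : nat) : R := (n == k)%:R.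

Let norm_ind k n : `|ind k n| <= 1.
Proof. by rewrite ger0_norm ?ler0n// lern1; case: eqP. Qed.

Let E_sum_ind (m : nat) (c : nat -> R) :
  (exists M, forall n, `|\sum_(k < m) c k * ind k n| <= M) /\
  E (fun n => \sum_(k < m) c k * ind k n) = \sum_(k < m) c k * E (ind k).
Proof.
elim: m => [|m [[M IHM] IHE]].
  split; first by exists 0 => n; rewrite big_ord0 normr0.
  by rewrite big_ord0 -[RHS](E_cst 0); congr E; apply/funext => n; rewrite big_ord0.
have cM n : `|c m * ind m n| <= `|c m| by rewrite normrM ler_piMr.
split.
  exists (M + `|c m|) => n; rewrite big_ord_recr /=.
  by rewrite (le_trans (ler_normD _ _))// lerD.
rewrite big_ord_recr /= -IHE /E.
under eq_Rintegral do rewrite big_ord_recr /=.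
rewrite (RintegralD measurableT (bounded_int IHM) (bounded_int cM)).
by rewrite (RintegralZl _ measurableT (bounded_int (norm_ind m))).
Qed.

Variables (p N : nat).
Local Notation r := p.+1.
Local Notation A f := (avg (fun w : word N r => f (inversions w))).

Hypothesis X_pgf : has_pgf X (fun q => r%:R ^- N * (galois_number R r N).[q]).

Let E_pow q : `|q| <= 1 -> E (fun n => q ^+ n) = A (fun n => q ^+ n).
Proof.
move=> q1; rewrite /E /Rintegral.
have := X_pgf q1; rewrite /pgf unlock => -> /=.
rewrite galois_numberE /avg horner_sum; congr (_ * _).
by apply: eq_bigr => w _; rewrite hornerXn.
Qed.

(** On [(0, 1]], the tail of the power series from the index [m] on is at most
    [q ^+ m]. *)
Let pow_split q m n : 0 < q <= 1 ->
  0 <= q ^+ n - \sum_(k < m) q ^+ k * ind k n <= q ^+ m.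
Proof.
move=> /andP[q0 q1]; have [nm|mn] := ltnP n m.
  rewrite (bigD1 (Ordinal nm))//= /ind eqxx mulr1 big1 => [|k]; last first.
    by rewrite -val_eqE /= eq_sym => /negPf ->; rewrite mulr0.
  by rewrite addr0 subrr lexx exprn_ge0// ltW.
rewrite big1 => [|k _]; last first.
  by rewrite /ind gtn_eqF ?mulr0// (leq_trans (ltn_ord k)).
by rewrite subr0 exprn_ge0 ?(ltW q0)//= -(subnKC mn) exprD ler_piMr ?exprn_ile1 ?exprn_ge0 ?(ltW q0).
Qed.

(** Strong induction on [m]: once the smaller atoms agree, the two generating
    functions truncated after [q ^+ m] differ by [O(q ^+ m.+1)], so that the atoms at
    [m] differ by at most [q], for every [q] in [(0, 1]]. *)
Let E_ind m : E (ind m) = A (ind m).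
Proof.
have [s] := ubnP m; elim: s m => // s IH m; rewrite ltnS => ms.
apply/eqP; rewrite -subr_eq0; apply/eqP; apply: eq0_small => q q01.
have /andP[q0 q1] := q01.
have qm0 : 0 < q ^+ m by rewrite exprn_gt0.
have [[M hM] hE] := E_sum_ind m.+1 (fun k => q ^+ k).
have pow1 n : `|q ^+ n| <= 1 by rewrite ger0_norm ?exprn_ge0 ?exprn_ile1 ?(ltW q0).
have hp n := pow_split m.+1 n q01.
have diffM n : `|q ^+ n - \sum_(k < m.+1) q ^+ k * ind k n| <= q ^+ m.+1.
  by have /andP[? ?] := hp n; rewrite ger0_norm.
have iD := @bounded_int (fun n => q ^+ n - \sum_(k < m.+1) q ^+ k * ind k n) _ diffM.
have E1 : E (fun n => q ^+ n) - \sum_(k < m.+1) q ^+ k * E (ind k) =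
    E (fun n => q ^+ n - \sum_(k < m.+1) q ^+ k * ind k n).
  by rewrite -hE /E (RintegralB measurableT (bounded_int pow1) (bounded_int hM)).
have E2 : 0 <= E (fun n => q ^+ n) - \sum_(k < m.+1) q ^+ k * E (ind k) <= q ^+ m.+1.
  rewrite E1; apply/andP; split.
    rewrite -[leLHS](E_cst 0); apply: (le_Rintegral measurableT (cst_int 0) iD).
    by move=> w _; have /andP[] := hp (X w).
  rewrite -[leRHS](E_cst (q ^+ m.+1)); apply: (le_Rintegral measurableT iD (cst_int _)).
  by move=> w _; have /andP[] := hp (X w).
have A2 : 0 <= A (fun n => q ^+ n) - \sum_(k < m.+1) q ^+ k * A (ind k) <= q ^+ m.+1.
  have -> : \sum_(k < m.+1) q ^+ k * A (ind k) =
      A (fun n => \sum_(k < m.+1) q ^+ k * ind k n).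
    by rewrite avg_sum; apply: eq_bigr => k _; rewrite avgZ.
  rewrite -avgB -[X in X <= _](avg_cst N p) -[X in _ <= _ <= X](avg_cst N p).
  apply/andP; split; apply: avg_le => w.
    by have /andP[] := hp (inversions w).
  by have /andP[] := hp (inversions w).
have Eq : E (fun n => q ^+ n) = A (fun n => q ^+ n).
  by apply: E_pow; rewrite ger0_norm// ltW.
move: E2 A2; rewrite Eq !big_ord_recr /=.
have -> : \sum_(k < m) q ^+ k * E (ind k) = \sum_(k < m) q ^+ k * A (ind k).
  by apply: eq_bigr => k _; rewrite IH// (leq_trans (ltn_ord k)).
move: (A (fun n => _)) (\sum_(k < m) _) (E (ind m)) (A (ind m)) => a b x y.
rewrite exprS => h1 h2.
rewrite -(ler_pM2l qm0) -[q ^+ m in leLHS]gtr0_norm// -normrM ler_norml.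
by apply/andP; split; lra.
Qed.

(** The atoms at the values that inversions take have total mass 1, so [X] almost
    surely takes one of them and the integral is a finite sum over atoms. *)
Lemma law_inversions (f : nat -> R) :
  (\int[P]_w (f (X w))%:E)%E = (A f)%:E.
Proof.
pose D := (\max_(w : word N r) inversions w).+1.
have invD (w : word N r) : (inversions w < D)%N by rewrite ltnS (bigD1 w)//= leq_maxl.
have A_sum (c : nat -> R) : A c = \sum_(k < D) c k * A (ind k).
  transitivity (A (fun n => \sum_(k < D) c k * ind k n)).
    apply: eq_avg => w.
    rewrite (bigD1 (Ordinal (invD w)))//= /ind eqxx mulr1 big1 ?addr0//.
    by move=> k; rewrite -val_eqE /= eq_sym => /negPf ->; rewrite mulr0.
  by rewrite avg_sum; apply: eq_bigr => k _; rewrite avgZ.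
pose tail n : R := (D <= n)%:R.
have tailE n : tail n = 1 - \sum_(k < D) 1 * ind k n.
  rewrite /tail; have [Dn|nD] := leqP D n.
    rewrite big1 ?subr0// => k _.
    by rewrite /ind gtn_eqF ?mulr0// (leq_trans (ltn_ord k)).
  rewrite (bigD1 (Ordinal nD))//= /ind eqxx mulr1 big1 ?addr0 ?subrr// => k.
  by rewrite -val_eqE /= eq_sym => /negPf ->; rewrite mulr0.
have norm_tail n : `|tail n| <= 1 by rewrite ger0_norm ?ler0n// lern1 leq_b1.
have tail_ae : ae_eq P setT (fun w => (tail (X w))%:E) (cst 0%E).
  apply/(ae_eq_integral_abs P measurableT).
    by apply: measurable_int (bounded_int norm_tail).
  transitivity (\int[P]_w (tail (X w))%:E)%E.
    by apply: eq_integral => w _; rewrite gee0_abs// lee_fin ler0n.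
  rewrite -(fineK (integrable_fin_num measurableT (bounded_int norm_tail))).
  congr EFin; have [[M hM] hE] := E_sum_ind D (fun _ => 1).
  transitivity (E (fun n => 1 - \sum_(k < D) 1 * ind k n)).
    by congr E; apply/funext.
  rewrite /E (RintegralB measurableT (cst_int 1) (bounded_int hM)).
  rewrite [X in X - _]E_cst [X in _ - X]hE.
  under eq_bigr do rewrite E_ind.
  by rewrite -(A_sum (fun _ => 1)) avg_cst subrr.
have [[M hM] hE] := E_sum_ind D f.
transitivity (\int[P]_w (\sum_(k < D) f k * ind k (X w))%:E)%E.
  apply: ae_eq_integral => //.
  - by apply/measurable_EFinP; apply: measurableT_comp => //; exact: measurable_funPT.
  - exact: measurable_int (bounded_int hM).
  - apply: filterS tail_ae => w + _ => /(_ I) /= [].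
    rewrite /tail; have [_ /eqP|XD _] := leqP D (X w); first by rewrite oner_eq0.
    congr EFin; rewrite (bigD1 (Ordinal XD))//= /ind eqxx mulr1 big1 ?addr0//.
    by move=> k; rewrite -val_eqE /= eq_sym => /negPf ->; rewrite mulr0.
rewrite -(fineK (integrable_fin_num measurableT (bounded_int hM))); congr EFin.
by rewrite [LHS]hE A_sum; apply: eq_bigr => k _; rewrite E_ind.
Qed.
End law.

(** * Continuous functions with compact support *)

Section compact_support.
Variables (R : realType) (u : R -> R) (B : R).
Hypotheses (u_cont : continuous u) (u_supp : forall x, B <= `|x| -> u x = 0).

Lemma compact_support_bounded : exists M, forall x, `|u x| <= M.
Proof.
have cu : {within `[- `|B|, `|B|], continuous u} by exact: continuous_subspaceT.
have /compact_bounded[M [_ hM]] :=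
  continuous_compact cu (@segment_compact _ (- `|B|) `|B|).
exists (`|M| + 1) => x.
have M1 : M < `|M| + 1 by rewrite ltr_pwDr// ler_norm.
have [xB|xB] := leP `|x| `|B|.
  by apply: (hM _ M1); exists x => //=; rewrite in_itv /= -ler_norml.
by rewrite u_supp ?normr0 ?addr_ge0// (le_trans (ler_norm _))// ltW.
Qed.

(** Uniform continuity in the form needed to average over a random increment:
    beyond the scale on which the oscillation is at most [e], the bound on [u]
    is absorbed by the quadratic term. *)
Lemma compact_support_modulus e : 0 < e ->
  exists2 C, 0 <= C & forall x h, `|u (x + h) - u x| <= e + C * h ^+ 2.
Proof.
move=> e0.
(* one unit more than the support, for [x + h] to be outside when [x] is not in [K] *)
pose K := `[- (`|B| + 1), `|B| + 1]%classic : set R.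
have /compact_near_coveringP/(_ R 0^'+ (fun t x => forall h, `|h| <= t ->
    `|u (x + h) - u x| <= e) _) : compact K by exact: segment_compact.
case.
  move=> x _; have /cvgrPdist_lt/(_ (e / 2)) := u_cont (x := x).
  rewrite divr_gt0// => /(_ isT) /nbhs_ballP[t /= t0 ht].
  exists (ball x (t / 2), [set s | s < t / 2]) => /=.
    split; first by apply: nbhsx_ballx; rewrite divr_gt0.
    by apply: nbhs_right_lt; rewrite divr_gt0.
  move=> [y s] /= [xy st] h hs.
  have uy : `|u x - u y| < e / 2.
    by apply: ht; apply: le_ball xy; lra.
  have uyh : `|u x - u (y + h)| < e / 2.
    apply: ht; rewrite /ball /= opprD addrA (le_lt_trans (ler_normB _ _))//.
    by move: xy; rewrite /ball /=; lra.
  have -> : u (y + h) - u y = (u x - u y) - (u x - u (y + h)) by ring.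
  rewrite (le_trans (ler_normB _ _))//; lra.
move=> t /= t0 ht.
have [M hM] := compact_support_bounded.
pose s := Num.min (t / 2) 1.
have s0 : 0 < s by rewrite lt_min ltr01 divr_gt0.
have hs x h : `|h| <= s -> `|u (x + h) - u x| <= e.
  move=> hs; have [xB|xB] := leP `|x| (`|B| + 1).
    apply: (ht s) => //.
      rewrite /ball /= sub0r normrN gtr0_norm// /s gt_min; apply/orP; left; lra.
    by rewrite /K /= in_itv /= -ler_norml.
  have h1 : `|h| <= 1 by rewrite (le_trans hs)// ge_min lexx orbT.
  have BB := ler_norm B.
  rewrite !u_supp ?subrr ?normr0 ?(ltW e0)//; first lra.
  have := lerB_dist x (- h); rewrite normrN opprK; lra.
have M0 : 0 <= M by rewrite (le_trans _ (hM 0)).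
exists (2 * M / s ^+ 2).
  by rewrite divr_ge0 ?exprn_ge0 ?mulr_ge0// ltW.
move=> x h; have [/hs xh|sh] := leP `|h| s.
  by rewrite (le_trans (xh x))// lerDl mulr_ge0 ?sqr_ge0// divr_ge0 ?exprn_ge0 ?mulr_ge0// ltW.
rewrite (le_trans (ler_normB _ _))// (le_trans (lerD (hM _) (hM _)))//.
rewrite -[leLHS]add0r lerD ?(ltW e0)// mulrAC ler_pdivlMr ?exprn_gt0//.
rewrite [X in X * _](_ : _ = 2 * M); last by ring.
rewrite ler_wpM2l ?mulr_ge0// -[h ^+ 2]real_normK ?num_real//.
by rewrite lerXn2r ?nnegrE ?normr_ge0// ltW.
Qed.
End compact_support.

Lemma taylor_modulus (R : realType) (g g' : R -> R) (e C : R) : 0 <= C ->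
  (forall x : R, is_derive x (1 : R) g (g' x)) ->
  (forall x h, `|g' (x + h) - g' x| <= e + C * h ^+ 2) ->
  forall x h, `|g (x + h) - g x - h * g' x| <= `|h| * (e + C * h ^+ 2).
Proof.
move=> C0 gD g'C x h.
have cg (i : interval R) : {within [set` i], continuous g}.
  by apply: derivable_within_continuous => y _; have [] := gD y.
have [t th ->] : exists2 t, `|t| <= `|h| & g (x + h) - g x = h * g' (x + t).
  have [h0|h0] := leP 0 h.
    have [|c] := @MVT_segment R g g' x (x + h) _ (fun y _ => gD y) (cg _).
      by rewrite lerDl.
    rewrite in_itv /= => /andP[xc ch] E; exists (c - x).
      by rewrite !ger0_norm; lra.
    by rewrite subrKC E mulrC [x + h]addrC addrK.
  have [|c] := @MVT_segment R g g' (x + h) x _ (fun y _ => gD y) (cg _).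
    by rewrite gerDl ltW.
  rewrite in_itv /= => /andP[xc ch] E; exists (c - x).
    by rewrite (ltr0_norm h0) ler0_norm; lra.
  by rewrite subrKC -opprB E; ring.
rewrite -mulrBr normrM ler_wpM2l// (le_trans (g'C _ _))// lerD2l ler_wpM2l//.
by rewrite -(real_normK (num_real t)) -(real_normK (num_real h)) lerXn2r.
Qed.

(** * The Stein equation of the normal law *)

Section gaussian.
Variable R : realType.
Local Notation mu := (@lebesgue_measure R).
Local Notation nu := (normal_prob (0 : R) 1).
Local Notation phi := (normal_pdf (0 : R) 1).

(** The density of [normal_prob m s] is a version of its Radon-Nikodym derivative
    with respect to the Lebesgue measure. *)
Lemma integral_normal_prob (m s : R) f U : measurable U -> measurable_fun U f ->
  (\int[normal_prob m s]_(x in U) `|f x| < +oo)%E ->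
  (\int[normal_prob m s]_(x in U) f x =
   \int[mu]_(x in U) (f x * (normal_pdf m s x)%:E))%E.
Proof.
move=> mU mf finf.
rewrite -(Radon_Nikodym_change_of_variables (normal_prob_dominates m s))//=; last first.
  by apply/integrableP; split.
apply: ae_eq_integral => //.
- apply: emeasurable_funM => //; apply: (measurable_int mu).
  apply: (integrableS _ _ (@subsetT _ _)) => //=.
  by apply: Radon_Nikodym_integrable; exact: normal_prob_dominates.
- apply: emeasurable_funM => //=; apply/measurableT_comp => //=.
  by apply/measurable_funTS; exact: measurable_normal_pdf.
- apply: ae_eqe_mul2l => /=.
  rewrite Radon_NikodymE//=; first exact: normal_prob_dominates.
  move=> abmu.
  (* two densities with the same integrals are almost everywhere equal *)
  case: cid => /= h [h1 h2 h3].
  apply: integral_ae_eq => //=.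
  + exact: integrableS h2.
  + by apply/measurable_funTS/measurableT_comp =>//; exact: measurable_normal_pdf.
  + by move=> E E01 mE; rewrite -h3.
Qed.

Lemma bounded_continuous_integrable f M : continuous f ->
  (forall x, `|f x| <= M) -> nu.-integrable setT (EFin \o f).
Proof.
move=> cf fM; apply: measurable_bounded_integrable => //.
- exact: (le_lt_trans (probability_le1 nu measurableT) (ltry 1)).
- exact: continuous_measurable_fun.
- exists M; split; first exact: num_real.
  by move=> x Mx y _ /=; rewrite (le_trans (fM _))// ltW.
Qed.

Lemma phi_gt0 x : 0 < phi x.
Proof.
by rewrite normal_pdfE ?oner_neq0// mulr_gt0 ?expR_gt0// normal_peak_gt0 ?oner_neq0.
Qed.

Lemma is_derive_inv_phi (x : R) :
  is_derive x (1 : R) (fun y => (phi y)^-1) (x * (phi x)^-1).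
Proof.
have E : (fun y => (phi y)^-1) = (fun y : R => (normal_peak 1)^-1 * expR (2^-1 * y ^+ 2)).
  apply/funext => y; rewrite normal_pdfE ?oner_neq0// invfM /normal_fun -expRN.
  by congr (_ * expR _); field.
rewrite E; have -> : (phi x)^-1 = (normal_peak 1)^-1 * expR (2^-1 * x ^+ 2).
  by have := congr1 (@^~ x) E.
apply: is_derive_eq.
by rewrite /GRing.scale /=; field; rewrite gt_eqF// normal_peak_gt0 ?oner_neq0.
Qed.

Section stein_equation.
Variables (k : R -> R) (B : R).
Hypotheses (k_cont : continuous k) (k_supp : forall x, B <= `|x| -> k x = 0).
Hypothesis k_mean : \int[nu]_x k x = 0.

Let kphi x := k x * phi x.

Let kphi_int : mu.-integrable setT (EFin \o kphi).
Proof.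
have [M hM] := compact_support_bounded k_cont k_supp.
apply: (@le_integrable _ _ _ mu setT measurableT _ (fun x => (M%:E * (phi x)%:E)%E)).
- apply/measurable_EFinP; apply: measurable_funM.
    exact: continuous_measurable_fun.
  exact: measurable_normal_pdf.
- move=> x _ /=; rewrite lee_fin /kphi !normrM ler_wpM2r//.
  by rewrite (le_trans (hM _))// ler_norm.
- by apply: integrableZl => //; exact: integrable_normal_pdf.
Qed.

Let kphi_mean : \int[mu]_x kphi x = 0.
Proof.
have [M hM] := compact_support_bounded k_cont k_supp.
have /integrableP[mk kfin] := bounded_continuous_integrable k_cont hM.
move: k_mean; rewrite /Rintegral integral_normal_prob//.
Qed.

Let H x := \int[mu]_(t in `]-oo, x]) kphi t.

Let H_derive (x : R) : is_derive x (1 : R) H (kphi x).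
Proof.
have [] := @continuous_FTC1 R kphi -oo%O x (x + 1).
- by rewrite ltrDl.
- exact: integrableS kphi_int.
- by rewrite ltNyr.
- apply: cvgM; first exact: k_cont.
  exact: (continuous_normal_pdf (oner_neq0 _)).
by move=> dH H'; split; rewrite // -derive1E.
Qed.

(** To the right of the support, the integral is complete and equals the mean of
    [k], which is zero. *)
Let H_supp x : B <= `|x| -> H x = 0.
Proof.
move=> Bx; rewrite /H; have [x0|x0] := leP 0 x; last first.
  rewrite [LHS](_ : _ = \int[mu]_(t in `]-oo, x]) 0); last apply: eq_Rintegral.
    by rewrite Rintegral_cst// mul0r.
  move=> t; rewrite inE /= in_itv /= => tx; rewrite /kphi k_supp ?mul0r//.
  move: Bx; rewrite !ltr0_norm ?(le_lt_trans tx)// => /le_trans; apply.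
  by rewrite lerN2.
rewrite Rintegral_mkcond -[RHS]kphi_mean; apply: eq_Rintegral => t _.
rewrite patchE; case: ifPn => //; rewrite notin_setE /= in_itv /= => /negP.
rewrite -ltNge => xt; rewrite /kphi k_supp ?mul0r//.
by move: Bx; rewrite !ger0_norm ?(le_trans x0 (ltW xt))// => /le_trans -> //; exact: ltW.
Qed.

(** The solution of [g' x - x * g x = k x] that vanishes at infinity.  As [k] has
    compact support and mean zero, the solution has compact support too, which
    replaces the usual estimates on its derivatives. *)
Definition stein_solution x := H x / phi x.

Lemma stein_solution_supp x : B <= `|x| -> stein_solution x = 0.
Proof. by move=> Bx; rewrite /stein_solution H_supp// mul0r. Qed.

Lemma stein_solution_derive (x : R) :
  is_derive x (1 : R) stein_solution (k x + x * stein_solution x).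
Proof.
have HD := H_derive x; have PD := is_derive_inv_phi x.
apply: is_derive_eq.
rewrite /GRing.scale /= /kphi /stein_solution.
have := phi_gt0 x; set c := phi x => c0.
by field; rewrite gt_eqF.
Qed.

End stein_equation.
End gaussian.

Section cutoff.
Variable R : realType.
Local Notation nu := (normal_prob (0 : R) 1).
Implicit Types (K x : R).

(** The piecewise linear function of [`|x|] equal to 1 up to [K] and to 0 from
    [2 * K] on, written with absolute values to make its continuity obvious. *)
Definition cutoff K x : R := (1 + `|2 - `|x| / K| - `|1 - `|x| / K|) / 2.

Lemma cutoff_continuous K : continuous (cutoff K).
Proof.
have c (a : R) : continuous (fun x : R => `|a - `|x| / K|).
  move=> x; apply: cvg_norm; apply: cvgB; first exact: cvg_cst.
  by apply: cvgM; [apply: cvg_norm; exact: cvg_id|exact: cvg_cst].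
move=> x; apply: cvgM; last exact: cvg_cst.
by apply: cvgB; [apply: cvgD; [exact: cvg_cst|exact: c]|exact: c].
Qed.

Let cutoffE K x : let t := `|x| / K in
  cutoff K x = if t <= 1 then 1 else if t <= 2 then 2 - t else 0.
Proof.
rewrite /cutoff; set t := `|x| / K => /=.
have [t1|t1] := leP t 1; first by rewrite !ger0_norm; lra.
have [t2|t2] := leP t 2; first by rewrite ger0_norm ?ltr0_norm; lra.
by rewrite !ltr0_norm; lra.
Qed.

Lemma cutoff_ge0 K x : 0 <= cutoff K x.
Proof.
rewrite cutoffE /=; move: (`|x| / K) => t; have [?|?] := leP t 1; first lra.
by have [?|?] := leP t 2; lra.
Qed.

Lemma cutoff_le1 K x : cutoff K x <= 1.
Proof.
rewrite cutoffE /=; move: (`|x| / K) => t; have [?|?] := leP t 1; first lra.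
by have [?|?] := leP t 2; lra.
Qed.

Lemma cutoff_eq1 K x : 0 < K -> `|x| <= K -> cutoff K x = 1.
Proof. by move=> K0 xK; rewrite cutoffE ler_pdivrMr// mul1r xK. Qed.

Lemma cutoff_supp K x : 0 < K -> 2 * K <= `|x| -> cutoff K x = 0.
Proof.
move=> K0; rewrite -ler_pdivlMr// cutoffE /=; move: (`|x| / K) => t t2.
have [?|?] := leP t 1; first lra.
by have [?|?] := leP t 2; lra.
Qed.

(** A Chebyshev bound: mass beyond the cutoff is paid for by second moments. *)
Lemma cutoff_compl_le K x : 0 < K -> 1 - cutoff K x <= x ^+ 2 / K ^+ 2.
Proof.
move=> K0; have [xK|xK] := leP `|x| K.
  by rewrite cutoff_eq1// subrr divr_ge0 ?sqr_ge0.
apply: (@le_trans _ _ 1); first by have := cutoff_ge0 K x; lra.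
rewrite ler_pdivlMr ?exprn_gt0// mul1r -[x ^+ 2]real_normK ?num_real//.
by rewrite lerXn2r ?nnegrE ?ltW// (lt_trans K0).
Qed.

Lemma gaussian_tail_cvg :
  \int[nu]_x (1 - cutoff n.+1%:R x) @[n --> \oo] --> (0 : R).
Proof.
have norm_le1 n x : `|1 - cutoff n.+1%:R x| <= 1.
  have := cutoff_ge0 n.+1%:R x; have := cutoff_le1 n.+1%:R x.
  by rewrite ler_norml => ? ?; apply/andP; split; lra.
have int1 n : nu.-integrable setT (EFin \o (fun x => 1 - cutoff n.+1%:R x)).
  apply: (@bounded_continuous_integrable _ _ 1).
    by move=> x; apply: cvgB; [exact: cvg_cst|exact: cutoff_continuous].
  exact: norm_le1.
have [|||||_ _] := @dominated_convergence _ _ _ nu setT measurableT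
  (fun n x => (1 - cutoff n.+1%:R x)%:E) (cst 0%E) (cst 1%E).
- by move=> n; exact: measurable_int (int1 n).
- by [].
- apply: aeW => x _; apply: cvg_near_cst; near=> n.
  rewrite cutoff_eq1 ?subrr// (@le_trans _ _ n%:R) ?ler_nat//; near: n.
  exact: nbhs_infty_ger.
- apply: (@bounded_continuous_integrable _ (cst 1) 1) => [|x].
    exact: cst_continuous.
  by rewrite normr1.
- by apply: aeW => x n _; rewrite lee_fin norm_le1.
rewrite integral0 => /fine_cvgP[_]; exact.
Unshelve. all: by end_near.
Qed.

(** Up to an error with a small quadratic bound, a bounded continuous function is a
    constant plus the Stein operator applied to a compactly supported function:
    [(f - a) * cutoff K] has normal mean zero for a suitable constant [a], and [a]
    is close to the normal mean of [f] when [K] is large. *)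
Lemma stein_test_function (f : R -> R) (M e : R) :
  continuous f -> (forall x, `|f x| <= M) -> 0 < e ->
  exists g g' B, [/\ continuous g, continuous g',
    forall x, B <= `|x| -> g x = 0 /\ g' x = 0,
    forall x : R, is_derive x (1 : R) g (g' x) &
    forall x, `|f x - \int[nu]_y f y - (g' x - x * g x)| <= e * (1 + x ^+ 2)].
Proof.
move=> cf fM e0.
have M0 : 0 <= M by rewrite (le_trans _ (fM 0)).
(* at most [1 / 2] for the mean of the cutoff to be bounded below, and at most
   [e / (2 * M + 1)] for [a] to be within [e] of the mean of [f] *)
pose dl := Num.min (1 / 2) (e / (2 * M + 1)).
have dl0 : 0 < dl by rewrite lt_min !divr_gt0//; lra.
have [K [K0 KM tailK]] : exists K : R, [/\ 0 < K, 2 * M / K ^+ 2 <= e &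
    \int[nu]_x (1 - cutoff K x) <= dl].
  have /cvgrPdist_le/(_ _ dl0) tl := gaussian_tail_cvg.
  near \oo => n; exists n.+1%:R; split => //.
    rewrite ler_pdivrMr ?exprn_gt0// -ler_pdivrMl//.
    apply: (@le_trans _ _ n.+1%:R).
      by rewrite (@le_trans _ _ n%:R) ?ler_nat//; near: n; exact: nbhs_infty_ger.
    by rewrite expr2 ler_peMl// ler1n.
  have : `|0 - \int[nu]_x (1 - cutoff n.+1%:R x)| <= dl by near: n; exact: tl.
  by rewrite sub0r normrN; apply: le_trans; exact: ler_norm.
pose chi := cutoff K.
have cchi : continuous chi := @cutoff_continuous K.
have chi01 x : 0 <= chi x <= 1 by rewrite cutoff_ge0 cutoff_le1.
have intB (h : R -> R) : continuous h -> (exists m, forall x, `|h x| <= m) ->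
    nu.-integrable setT (EFin \o h).
  by move=> ch [m hm]; exact: bounded_continuous_integrable ch hm.
have ichi : nu.-integrable setT (EFin \o chi).
  by apply: intB => //; exists 1 => x; rewrite ger0_norm; have /andP[] := chi01 x.
have ione : nu.-integrable setT (EFin \o (fun _ : R => 1 : R)).
  by apply: intB => [x|]; [exact: cvg_cst|exists 1 => x; rewrite normr1].
have Icst (c : R) : \int[nu]_x c = c.
  by rewrite Rintegral_cst//= [X in fine X](probability_setT nu) mulr1.
have chi_mean : 1 / 2 <= \int[nu]_x chi x.
  move: tailK; rewrite (RintegralB measurableT ione ichi) Icst.
  by rewrite /dl le_min => /andP[+ _]; lra.
have ifchi : nu.-integrable setT (EFin \o (fun x => f x * chi x)).
  apply: intB => [x|]; first by apply: cvgM; [exact: cf|exact: cchi].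
  exists M => x; have /andP[? ?] := chi01 x.
  by rewrite normrM (ger0_norm (x := chi x))// (le_trans _ (fM x))// ler_piMr.
(* the constant for which [(f - a) * chi] has normal mean zero *)
pose a := (\int[nu]_x (f x * chi x)) / (\int[nu]_x chi x).
have chi_mean0 : 0 < \int[nu]_x chi x by apply: lt_le_trans chi_mean; lra.
have aM : `|a| <= M.
  rewrite normrM normfV (gtr0_norm chi_mean0) ler_pdivrMr//.
  rewrite (le_trans (le_normr_Rintegral measurableT ifchi))//.
  rewrite -(RintegralZl _ measurableT ichi).
  apply: (le_Rintegral measurableT (integrable_norm ifchi)).
    apply: intB => [x|]; first by apply: cvgM; [exact: cvg_cst|exact: cchi].
    exists M => x; have /andP[? ?] := chi01 x.
    by rewrite normrM (ger0_norm M0) (ger0_norm (x := chi x))// ler_piMr.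
  move=> x _ /=; have /andP[? ?] := chi01 x.
  by rewrite normrM (ger0_norm (x := chi x))// ler_wpM2r.
pose k x := (f x - a) * chi x.
have ck : continuous k.
  move=> x; apply: cvgM; last exact: cchi.
  by apply: cvgB; [exact: cf|exact: cvg_cst].
have k_supp x : 2 * K <= `|x| -> k x = 0.
  by move=> Kx; rewrite /k /chi cutoff_supp ?mulr0.
have k_mean : \int[nu]_x k x = 0.
  rewrite /k; under eq_Rintegral do rewrite mulrBl.
  rewrite (RintegralB measurableT ifchi) ?(RintegralZl _ measurableT ichi)//.
    by rewrite /a divfK ?subrr// gt_eqF.
  exact: (integrableZl measurableT a ichi).
have i1chi : nu.-integrable setT (EFin \o (fun x => 1 - chi x)).
  apply: intB => [x|]; first by apply: cvgB; [exact: cvg_cst|exact: cchi].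
  by exists 1 => x; have /andP[? ?] := chi01 x; rewrite ger0_norm; lra.
have rest_le x : `|(f x - a) * (1 - chi x)| <= 2 * M * (1 - chi x).
  have /andP[chi0 chi1] := chi01 x.
  rewrite normrM (ger0_norm (x := 1 - chi x)) ?subr_ge0// ler_wpM2r ?subr_ge0//.
  by rewrite (le_trans (ler_normB _ _))// mulr_natl mulr2n lerD.
have IfE : `|\int[nu]_x f x - a| <= e.
  have ir : nu.-integrable setT (EFin \o (fun x => (f x - a) * (1 - chi x))).
    apply: intB => [x|].
      by apply: cvgM; apply: cvgB; [exact: cf|exact: cvg_cst|exact: cvg_cst|exact: cchi].
    exists (2 * M) => x; rewrite (le_trans (rest_le x))//.
    by rewrite ler_piMr ?mulr_ge0//; have /andP[? ?] := chi01 x; lra.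
  have -> : \int[nu]_x f x - a = \int[nu]_x ((f x - a) * (1 - chi x)).
    have ifa : nu.-integrable setT (EFin \o (fun x => f x - a)).
      apply: intB => [x|]; first by apply: cvgB; [exact: cf|exact: cvg_cst].
      exists (M + `|a|) => x.
      by rewrite (le_trans (ler_normB _ _))// lerD2r.
    have ik : nu.-integrable setT (EFin \o k).
      by apply: intB => //; exact: (compact_support_bounded ck k_supp).
    have if_ : nu.-integrable setT (EFin \o f) by apply: intB => //; exists M.
    have ia : nu.-integrable setT (EFin \o (fun _ : R => a)).
      by apply: intB => [x|]; [exact: cvg_cst|exists `|a|].
    rewrite -[LHS]subr0 -[X in _ - X]k_mean -{1}[a]Icst.
    rewrite -(RintegralB measurableT if_ ia) -(RintegralB measurableT ifa ik).
    by apply: eq_Rintegral => x _; rewrite /k; ring.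
  rewrite (le_trans (le_normr_Rintegral measurableT ir))//.
  apply: (@le_trans _ _ (2 * M * \int[nu]_x (1 - chi x))).
    rewrite -(RintegralZl _ measurableT i1chi).
    apply: (le_Rintegral measurableT (integrable_norm ir)).
      exact: (integrableZl measurableT (2 * M) i1chi).
    by move=> x _; exact: rest_le.
  rewrite (le_trans (ler_wpM2l _ tailK)) ?mulr_ge0//.
  apply: (@le_trans _ _ (2 * M * (e / (2 * M + 1)))).
    by rewrite ler_wpM2l ?mulr_ge0// ge_min lexx orbT.
  by rewrite mulrA ler_pdivrMr; [nra|lra].
pose g := stein_solution k.
have gD := stein_solution_derive ck k_supp.
have cg : continuous g.
  move=> x; apply: differentiable_continuous; apply/derivable1_diffP.
  by have [] := gD x.
exists g, (fun x => k x + x * g x), (2 * K); split => //.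
- move=> x; apply: cvgD; first exact: ck.
  by apply: cvgM; [exact: cvg_id|exact: cg].
- move=> x Kx; rewrite (k_supp _ Kx) /g (stein_solution_supp ck k_supp k_mean Kx).
  by rewrite mulr0 addr0.
- move=> x.
  rewrite (addrK (x * g x)).
  have -> : f x - \int[nu]_y f y - k x =
      (a - \int[nu]_y f y) + (f x - a) * (1 - chi x) by rewrite /k; ring.
  rewrite (le_trans (ler_normD _ _))// [e * _]mulrDr mulr1 lerD//; first by rewrite distrC.
  rewrite (le_trans (rest_le x))//.
  apply: (@le_trans _ _ ((2 * M) * (x ^+ 2 / K ^+ 2))).
    by rewrite ler_wpM2l ?mulr_ge0// cutoff_compl_le.
  by rewrite mulrCA mulrC ler_wpM2r ?sqr_ge0.
Unshelve. all: by end_near.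
Qed.

End cutoff.

(** * The central limit theorem *)

Section clt.
Variable R : realType.

Definition standard_inversions p N (w : word N p.+1) : R :=
  ((inversions w)%:R - mean_inversions R p N) / Num.sqrt (var_inversions R p N).

(** The error terms are quadratic in the standardized number of inversions, whose
    second moment is 1, or decrease like [(2 * N + 5)^-1]. *)
Lemma inversions_clt p (f : R -> R) M : (0 < p)%N ->
  continuous f -> (forall x, `|f x| <= M) ->
  avg (fun w => f (@standard_inversions p N w)) @[N --> \oo]
    --> \int[normal_prob 0 1]_x f x.
Proof.
move=> p0 cf fM; apply/cvgrPdist_le => e e0.
(* twice [e / 6] for the cutoff, three times for the moduli, once for what decreases *)
have e60 : 0 < e / 6 by rewrite divr_gt0.
have [g [g' [B [cg cg' supp gD gf]]]] := stein_test_function cf fM e60.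
have g'supp x : B <= `|x| -> g' x = 0 by move=> /supp[].
pose k x := g' x - x * g x.
have ck : continuous k.
  move=> x; apply: cvgB; first exact: cg'.
  by apply: cvgM; [exact: cvg_id|exact: cg].
have ksupp x : B <= `|x| -> k x = 0.
  by move=> /supp[gx g'x]; rewrite /k gx g'x mulr0 subr0.
have [M' g'M] := compact_support_bounded cg' g'supp.
have [C1 C10 g'C1] := compact_support_modulus cg' g'supp e60.
have [C2 C20 kC2] := compact_support_modulus ck ksupp e60.
pose C := C1 + C2.
have C0 : 0 <= C by rewrite addr_ge0.
have g'C x h : `|g' (x + h) - g' x| <= e / 6 + C * h ^+ 2.
  rewrite (le_trans (g'C1 x h))// lerD2l ler_wpM2r ?sqr_ge0//.
  by rewrite /C lerDl.
have kC x h : `|k (x + h) - k x| <= e / 6 + C * h ^+ 2.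
  rewrite (le_trans (kC2 x h))// lerD2l ler_wpM2r ?sqr_ge0//.
  by rewrite /C lerDr.
have gT := taylor_modulus C0 gD g'C.
have M'0 : 0 <= M' by rewrite (le_trans _ (g'M 0)).
near=> N.
have N2 : (2 <= N)%N by near: N; exact: nbhs_infty_ge.
have N0 : 2 <= N%:R :> R by rewrite ler_nat.
pose v := var_inversions R p N.
have r2 : 2 <= p.+1%:R :> R by rewrite ler_nat.
have v0 : 0 < v.
  rewrite /v /var_inversions !(mulr_gt0, divr_gt0, invr_gt0, exprn_gt0)//; lra.
have s0 : 0 < Num.sqrt v by rewrite sqrtr_gt0.
have sE : Num.sqrt v ^+ 2 = v by rewrite sqr_sqrtr// ltW.
have bound := stein_inversions p0 N2 g'M C0 g'C gT kC s0 sE.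
have small : (3 * M' + 195 * C) / (2 * N%:R + 5) <= e / 6.
  have c0 : 0 <= 3 * M' + 195 * C by rewrite addr_ge0 ?mulr_ge0.
  rewrite ler_pdivrMr; last lra.
  rewrite -ler_pdivrMl//; apply: (@le_trans _ _ N%:R); last lra.
  near: N; exact: nbhs_infty_ger.
set If := Rintegral _ _ _.
set A := avg _.
pose W w := @standard_inversions p N w.
have W2 : avg (fun w => 1 + W w ^+ 2) = 2.
  rewrite avgD avg_cst.
  have -> : avg (fun w => W w ^+ 2) = avg (fun w : word N p.+1 =>
       v^-1 * ((inversions w)%:R - mean_inversions R p N) ^+ 2).
    by apply: eq_avg => w; rewrite /W /standard_inversions expr_div_n sE mulrC.
  by rewrite avgZ avg_inversions_sqr mulVf ?gt_eqF.
have gfI x : `|f x - If - k x| <= e / 6 * (1 + x ^+ 2) by exact: gf.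
have dist : `|A - If - avg (fun w => k (W w))| <= e / 6 * 2.
  rewrite -W2 -avgZ.
  have -> : A - If - avg (fun w => k (W w)) = avg (fun w => f (W w) - If - k (W w)).
    by rewrite !avgB avg_cst.
  rewrite (le_trans (avg_norm _))//; apply: avg_le => w; exact: gfI.
rewrite distrC -(subrK (avg (fun w => k (W w))) (A - If)).
rewrite (le_trans (ler_normD _ _))// (le_trans (lerD dist bound))//.
move: small; lra.
Unshelve. all: by end_near.
Qed.

End clt.

Section moments.
Context d (T : measurableType d) (R : realType) (P : probability T R).
Variables (G : {RV P >-> nat}) (p N : nat).
Hypothesis G_pgf :
  has_pgf G (fun q => p.+1%:R ^- N * (galois_number R p.+1 N).[q]).

Lemma expectation_inversions : 'E_P[real_rv G]%E = (mean_inversions R p N)%:E.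
Proof.
rewrite unlock; have := law_inversions G_pgf (fun n => n%:R).
by rewrite avg_inversions => <-.
Qed.

Lemma variance_inversions : 'V_P[real_rv G]%E = (var_inversions R p N)%:E.
Proof.
rewrite /variance unlock expectation_inversions unlock /=.
have := law_inversions G_pgf (fun n => (n%:R - mean_inversions R p N) ^+ 2).
by rewrite avg_inversions_sqr => <-.
Qed.

Lemma standardized_inversions (f : R -> R) M :
  continuous f -> (forall x, `|f x| <= M) ->
  (\int[distribution P (standardized G)]_x (f x)%:E)%E =
  (avg (fun w => f (@standard_inversions R p N w)))%:E.
Proof.
move=> cf fM.
have mf : measurable_fun setT f by exact: continuous_measurable_fun.
rewrite integral_distribution.
- have := law_inversions G_pgf (fun n => f ((n%:R - mean_inversions R p N) / Num.sqrt (var_inversions R p N))).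
  move=> <-; apply: eq_integral => w _.
  by rewrite /= /standardized expectation_inversions variance_inversions.
- exact/measurable_EFinP.
- apply: measurable_bounded_integrable => //.
  + exact: (le_lt_trans (probability_le1 P measurableT) (ltry 1)).
  + by apply: measurableT_comp => //; exact: measurable_funPT.
  + exists M; split; first exact: num_real.
    by move=> x Mx w _ /=; rewrite (le_trans (fM _))// ltW.
Qed.
End moments.

Theorem theorem3p5 (R : realType) (r : nat) (hr : (2 <= r)%N) :
  (forall (N : nat) (d : measure_display) (T : measurableType d)
      (P : probability T R) (G : {RV P >-> nat}),
    has_pgf G (fun q => r%:R ^- N * (galois_number R r N).[q]) ->
    'E_P[real_rv G]%E = ((r%:R - 1) / (4 * r%:R) * N%:R * (N%:R - 1))%:E /\
    'V_P[real_rv G]%E = ((r%:R - 1) * (r%:R + 1) / (72 * r%:R ^+ 2)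
                         * N%:R * (N%:R - 1) * (2 * N%:R + 5))%:E) /\
  (forall (d : nat -> measure_display) (T : forall N, measurableType (d N))
      (P : forall N, probability (T N) R) (G : forall N, {RV (P N) >-> nat}),
    (forall N, has_pgf (G N)
       (fun q => r%:R ^- N * (galois_number R r N).[q])) ->
    weakly_cvg (fun N => distribution (P N) (standardized (G N)))
               (normal_prob 0 1)).
Proof.
case: r hr => // p; rewrite ltnS => p0; split.
  move=> N d T P G Gpgf; split; last exact: variance_inversions.
  have -> : p.+1%:R - 1 = p%:R :> R by rewrite -natr1 addrK.
  exact: expectation_inversions.
move=> d T P G Gpgf f cf [M0 [_ fM0]].
have fM x : `|f x| <= `|M0| + 1.
  by apply: fM0 => //; rewrite ltr_pwDr// ler_norm.
under eq_fun do rewrite (standardized_inversions (Gpgf _) cf fM).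
rewrite -(fineK (integrable_fin_num measurableT (bounded_continuous_integrable cf fM))).
by apply: cvg_EFin; [exact: nearW|exact: inversions_clt p0 cf fM].
Qed.
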